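(* For every sufficiently large power of two $n$, there are a partial function $f:\{0,1\}^{2n^2}\to\{0,1,*\}$, an input $z\in f^{-1}( * )$, and total predicates $\varphi_0,\varphi_1:\{0,1\}^{2n^2}\times\{0,1\}^{\ell'}\to\{0,1\}$ with a common descriptor length $\ell'=\Theta(n\log n)$, such that: 1. $n\le \mathrm{C}(f)\le O(n\log n)$ and \[ \mathrm{C}_{\overline 1}(f,z)\ge \frac{n(n-1)}{2},\qquad \mathrm{C}_{\overline 0}(f,z)\ge \bigl(\tfrac12+o(1)\bigr)n^2; \] 2. for each $b\in\{0,1\}$ and each $x\in\{0,1\}^{2n^2}$: $f(x)=b$ if and only if there exists a descriptor $y\in\{0,1\}^{\ell'}$ with $\varphi_b(x,y)=1$; 3. each accepted descriptor persists after fixing a descriptor-dependent set of at most $O(n\log n)$ input coordinates: for each $b\in\{0,1\}$, each descriptor $y$ determines a set $I_b(y)\subseteq[2n^2]$ with $|I_b(y)|=O(n\log n)$ such that whenever $\varphi_b(x,y)=1$, we have $\varphi_b(x',y)=1$ for every $x'\in\{0,1\}^{2n^2}$ agreeing with $x$ on $I_b(y)$; 4. $\widetilde{\deg}(\varphi_0)=\widetilde{O}(\sqrt n)$ and $\widetilde{\deg}(\varphi_1)=\widetilde{O}(\sqrt n)$. Here the asymptotic notation is as $n\to\infty$ over powers of two (with constants not depending on $n$).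
   Context: A partial Boolean function is a map $f:\{0,1\}^N\to\{0,1,*\}$. A partial assignment is a string $\rho\in\{0,1,*\}^N$; its size $|\rho|$ is the number of $i$ with $\rho_i\ne *$; $x\in\{0,1\}^N$ is consistent with $\rho$ (a completion of $\rho$) if $\rho_i=x_i$ whenever $\rho_i\neq *$. For $\Sigma\subseteq\{0,1,*\}$ and $x$ with $f(x)\in\Sigma$, a $\Sigma$-certificate for $x$ is a partial assignment $\rho$ consistent with $x$ such that every completion $x'$ of $\rho$ has $f(x')\in\Sigma$; $\mathrm{C}_\Sigma(f,x)$ is the minimum size of a $\Sigma$-certificate for $x$, and $\mathrm{C}_\Sigma(f)=\max_{x\in f^{-1}(\Sigma)}\mathrm{C}_\Sigma(f,x)$ (with $\max\varnothing=0$). For $b\in\{0,1\}$, $\mathrm{C}_b=\mathrm{C}_{\{b\}}$, and $\mathrm{C}(f)=\max\{\mathrm{C}_0(f),\mathrm{C}_1(f)\}$. For $x\in f^{-1}( * )$ put $\mathrm{C}_{\overline 0}(f,x)=\mathrm{C}_{\{1,*\}}(f,x)$ and $\mathrm{C}_{\overline 1}(f,x)=\mathrm{C}_{\{0,*\}}(f,x)$. For a total Boolean function $g$ on $\{0,1\}^N$, $\widetilde{\deg}(g)$ is the least degree of a real polynomial $p$ with $|p(x)-g(x)|\le 1/3$ for all $x\in\{0,1\}^N$. Logarithms are base $2$; $\widetilde O$ suppresses factors polylogarithmic in $n$. *)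

(* Defs.v *)
From mathcomp Require Import all_boot all_order all_algebra.
From mathcomp Require Import boolp reals.
From mathcomp Require Import mpoly.

Set Implicit Arguments.
Unset Strict Implicit.
Unset Printing Implicit Defensive.

Import Order.TTheory GRing.Theory Num.Theory.

Definition bits (N : nat) := {ffun 'I_N -> bool}.

(* [None] is the symbol [*], both as a value of a partial function and as a
   free coordinate of a partial assignment. *)
Definition partial_fun (N : nat) := bits N -> option bool.
Definition passign (N : nat) := {ffun 'I_N -> option bool}.

Section Certificates.
Variable N : nat.
Implicit Types (f : partial_fun N) (x : bits N) (rho : passign N).
Implicit Type Sigma : {set option bool}.

Definition psize rho := #|[set i | rho i != None]|.

Definition consistent rho x := [forall i, (rho i != None) ==> (rho i == Some (x i))].

Definition is_cert Sigma f x rho :=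
  consistent rho x && [forall x' : bits N, consistent rho x' ==> (f x' \in Sigma)].

Definition full_assign x : passign N := [ffun i => Some (x i)].

Lemma full_assign_is_cert Sigma f x :
  f x \in Sigma -> is_cert Sigma f x (full_assign x).
Proof.
move=> fx; apply/andP; split; first by apply/forallP=> i; rewrite ffunE eqxx.
apply/forallP=> x'; apply/implyP=> /forallP cx'.
suff -> : x' = x by [].
by apply/ffunP=> i; have := cx' i; rewrite ffunE => /eqP [].
Qed.

(* Meaningful only when [f x \in Sigma]: then the default [full_assign x] is a
   certificate and [arg min] returns a certificate of minimum size. *)
Definition cert_at Sigma f x : nat :=
  psize [arg min_(rho < full_assign x | is_cert Sigma f x rho) psize rho].

Definition cert_set Sigma f : nat := \max_(x | f x \in Sigma) cert_at Sigma f x.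

Definition cert_b (b : bool) f : nat := cert_set [set Some b] f.

Definition cert f : nat := maxn (cert_b false f) (cert_b true f).

(* The certificate complexity of "not b" at an input, where "not b" is
   {1 - b, *}; used at inputs with [f x = None]. *)
Definition cert_not_at (b : bool) f x : nat := cert_at [set Some (~~ b); None] f x.

End Certificates.

Section ApproximateDegree.
Variables (R : realType) (N : nat).
Local Open Scope ring_scope.
Implicit Types (p : {mpoly R[N]}) (g : bits N -> bool).

(* Total degree; [msize] is one more than the degree for nonzero [p], and the
   zero polynomial gets degree 0. *)
Definition mdegree p : nat := (msize p).-1.

Definition approximates p g : Prop :=
  forall x : bits N, `|p.@[fun i => (x i)%:R] - (g x)%:R| <= 1 / 3%:R.

Definition has_approx_of_degree g (d : nat) : Prop :=
  exists p, mdegree p = d /\ approximates p g.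

Lemma approx_exists g : exists d, `[< has_approx_of_degree g d >].
Proof.
pose p : {mpoly R[N]} :=
  \sum_(y : bits N | g y) \prod_(i < N) (if y i then 'X_i else 1 - 'X_i).
exists (mdegree p); apply/asboolP; exists p; split=> // x.
suff -> : p.@[fun i => (x i)%:R] = (g x)%:R by rewrite subrr normr0 divr_ge0 // ler0n.
rewrite /p raddf_sum /=.
have E (y : bits N) : (\prod_(i < N) (if y i then 'X_i else 1 - 'X_i)).@[fun i => (x i)%:R]
    = (x == y)%:R :> R.
  rewrite rmorph_prod /=; have [<-|neq] := eqVneq x y.
    rewrite big1 // => i _; case xi: (x i); first by rewrite mevalXU xi.
    by rewrite mevalB meval1 mevalXU xi subr0.
  have /existsP[i xyi] : [exists i, x i != y i].
    by rewrite -negb_forall; apply: contra neq => /forallP H; apply/eqP/ffunP=> i; apply/eqP.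
  rewrite (bigD1 i) //=; move: xyi; case: (y i); case xi: (x i) => // _.
    by rewrite mevalXU xi mul0r.
  by rewrite mevalB meval1 mevalXU xi subrr mul0r.
rewrite (eq_bigr (fun y => (x == y)%:R)) => [|y _]; last exact: E.
case gx: (g x).
  rewrite (bigD1 x) //= eqxx big1 ?addr0 // => y /andP[_ ny].
  by rewrite eq_sym (negbTE ny).
by rewrite big1 // => y gy; case: eqP => // xy; rewrite xy gy in gx.
Qed.

Definition approx_deg g : nat := ex_minn (approx_exists g).

End ApproximateDegree.

(* A predicate of an input and a descriptor, as one Boolean function of the
   concatenated string. *)
Definition joint (N l : nat) (phi : bits N -> bits l -> bool) : bits (N + l) -> bool :=
  fun w => phi [ffun i => w (lshift l i)] [ffun j => w (rshift N j)].

(* Main.v *)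
(* Let n = 2 ^ k. The input consists of a bit A_e for each leaf e of the complete
   binary tree of depth 2k and of an n by n grid of bits B_{g,h}; every nonroot node
   v of the tree is labelled by four rows G v 0, ..., G v 3 of the grid. A leaf e
   certifies the value 1 if A_e = 1 and all rows labelling the nodes on the path
   from the root to e vanish. A column h certifies the value 0 with the help of a
   set T of at most 2n nodes containing the root: a child of a node in T must be in
   T unless B_{g,h} = 1 for one of its rows g, and A_e = 0 must hold for the leaves
   e in T. Following the path to e shows that the two kinds of certificates exclude
   each other.

   To refute the value 1 at the zero input one has to touch every A_e. A partial
   assignment fixing fewer than n^2 / 2 bits to 0 touches, in some column h, a set W
   of at most n / 2 rows; setting the rest of this column to 1 gives a 0-input
   provided that few nodes are connected to the root by nodes labelled within W. For
   random labels this component is a subcritical Galton-Watson tree, so that its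
   size has an exponential tail, and a union bound over W applies.

   Descriptors list T together with pointers from each node to its children, so that
   validity is a conjunction of O(n log n) tests, each made by a decision tree of
   depth O(log n). Chebyshev polynomials approximate the conjunction. *)
Require Import Defs.
From mathcomp Require Import all_boot all_order all_algebra.
From mathcomp Require Import classical_sets reals topology normedtype sequences.
From mathcomp Require Import boolp.
From mathcomp Require Import -(notations) mpoly.
From mathcomp Require Import zify ring lra.

Set Implicit Arguments.
Unset Strict Implicit.
Unset Printing Implicit Defensive.

Import Order.TTheory GRing.Theory Num.Theory.
Import numFieldNormedType.Exports.
Local Open Scope classical_set_scope.
Local Open Scope ring_scope.

(** * Polynomials for conjunctions of local tests *)

Section ExactDegree.
Variables (R : realType) (N : nat).
Implicit Types (p q : mpoly N R) (g : bits N -> bool) (d : nat).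

Definition bit_eval (x : bits N) p : R := meval (fun i => (x i)%:R) p.

Definition exact_deg d g :=
  exists p, (msize p <= d.+1)%N /\ forall x, bit_eval x p = (g x)%:R.

Definition query_deg d (T : finType) (a : bits N -> T) :=
  forall t, exact_deg d (fun x => a x == t).

Lemma msize_mul p q d1 d2 :
  (msize p <= d1.+1 -> msize q <= d2.+1 -> msize (p * q) <= (d1 + d2).+1)%N.
Proof.
have [->|p0] := eqVneq p 0; first by rewrite mul0r msize0.
have [->|q0] := eqVneq q 0; first by rewrite mulr0 msize0.
rewrite msizeM //; move: (mmeasure mdeg p) (mmeasure mdeg q) => a b; lia.
Qed.

Lemma msize_add p q d :
  (msize p <= d.+1 -> msize q <= d.+1 -> msize (p + q) <= d.+1)%N.
Proof. by move=> hp hq; apply: leq_trans (msizeD_le _ _) _; rewrite geq_max hp. Qed.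

Lemma msize_bigsum (T : finType) (F : T -> mpoly N R) d :
  (forall t, msize (F t) <= d.+1)%N -> (msize (\sum_t F t) <= d.+1)%N.
Proof.
move=> hF; elim/big_rec: _ => [|t p _ hp]; first by rewrite msize0.
exact: msize_add.
Qed.

Lemma msize_bigprod (T : finType) (F : T -> mpoly N R) d :
  (forall t, msize (F t) <= d.+1)%N -> (msize (\prod_t F t) <= (#|T| * d).+1)%N.
Proof.
move=> hF; rewrite -big_enum cardE.
elim: (enum T) => [|t s IH]; first by rewrite big_nil msize1.
by rewrite big_cons mulSn; apply: msize_mul.
Qed.

Lemma exact_deg_ext d g g' : g =1 g' -> exact_deg d g -> exact_deg d g'.
Proof. by move=> e [p [hp E]]; exists p; split=> // x; rewrite E e. Qed.

Lemma exact_deg_leq d d' g : (d <= d')%N -> exact_deg d g -> exact_deg d' g.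
Proof. by move=> le [p [hp E]]; exists p; split=> //; apply: leq_trans hp _. Qed.

Lemma exact_deg_const d (c : bool) : exact_deg d (fun=> c).
Proof.
exists (if c then 1 else 0); split=> [|x]; first by case: c; rewrite ?msize1 ?msize0.
by rewrite /bit_eval; case: c; rewrite ?rmorph1 ?raddf0.
Qed.

(* The polynomial is the sum over [t] of the indicator of [a x = t] times [F t]:
   reading adaptively adds the degrees. *)
Lemma exact_deg_bind d1 d2 (T : finType) (a : bits N -> T) (F : T -> bits N -> bool) :
  query_deg d1 a -> (forall t, exact_deg d2 (F t)) ->
  exact_deg (d1 + d2) (fun x => F (a x) x).
Proof.
move=> /choice [A HA] /choice [B HB].
exists (\sum_t A t * B t); split=> [|x].
  by apply: msize_bigsum => t; apply: msize_mul; [case: (HA t)|case: (HB t)].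
have E t : bit_eval x (A t * B t) = (a x == t)%:R * (F t x)%:R.
  by rewrite -(HA t).2 -(HB t).2 /bit_eval rmorphM.
rewrite [bit_eval _ _]raddf_sum /= (bigD1 (a x)) //= [meval _ _]E eqxx mul1r.
by rewrite big1 ?addr0 // => t nt; rewrite [meval _ _]E eq_sym (negbTE nt) mul0r.
Qed.

Lemma query_deg_map d (T U : finType) (a : bits N -> T) (h : T -> U) :
  query_deg d a -> query_deg d (fun x => h (a x)).
Proof.
move=> Ha u; rewrite -[d]addn0.
exact: (exact_deg_bind Ha (fun t => exact_deg_const 0 (h t == u))).
Qed.

Lemma query_deg_read (T : finType) (f : T -> 'I_N) :
  query_deg #|T| (fun x => [ffun t => x (f t)] : {ffun T -> bool}).
Proof.
move=> u; pose X t : mpoly N R := mpolyX R (mnm1 (f t)).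
exists (\prod_t (if u t then X t else 1 - X t)); split=> [|x].
  rewrite -[#|T|]muln1; apply: msize_bigprod => t.
  have sX : (msize (X t) <= 2)%N by rewrite msizeX mdeg1.
  case: (u t) => //; apply: msize_add; first by rewrite msize1.
  by rewrite msizeN.
have E t : bit_eval x (if u t then X t else 1 - X t) = (x (f t) == u t)%:R.
  rewrite /bit_eval; case: (u t); rewrite ?raddfB /= ?meval1 mevalXU; case: (x (f t)) => //=;
  by rewrite ?subrr ?subr0.
rewrite /bit_eval rmorph_prod /= (eq_bigr _ (fun t _ => E t)).
have [<-|ne] := eqVneq [ffun t => x (f t)] u; first by rewrite big1 // => t _; rewrite ffunE eqxx.
have [/eqfunP H|/forallPn /= [t nt]] := boolP [forall t, x (f t) == u t].
  by case/eqP: ne; apply/ffunP => t; rewrite ffunE H.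
by rewrite (bigD1 t) //= (negbTE nt) mul0r.
Qed.

Lemma exact_deg_junta (T : finType) (f : T -> 'I_N) (P : {ffun T -> bool} -> bool) d :
  (#|T| <= d)%N -> exact_deg d (fun x => P [ffun t => x (f t)]).
Proof.
move=> le; apply: (exact_deg_leq le); rewrite -[#|T|]addn0.
exact: (exact_deg_bind (query_deg_read f) (fun u => exact_deg_const 0 (P u))).
Qed.

End ExactDegree.

(** * Chebyshev polynomials inside and outside [[-1, 1]] *)

Section Chebyshev.
Variable R : realType.
Implicit Types (x : R) (d : nat).

(* The pair (T_d, U_(d-1)) of Chebyshev polynomials. *)
Fixpoint cheb (A : comNzRingType) (d : nat) (x : A) : A * A :=
  if d is d'.+1 then
    let: (t, u) := cheb d' x in (x * t + (x ^+ 2 - 1) * u, t + x * u)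
  else (1, 0).

(** Pell's equation: [t + u * sqrt (x ^ 2 - 1)] is the [d]-th power of [x + sqrt (x ^ 2 - 1)], which
    has norm 1. *)
Lemma cheb_pell d x : (cheb d x).1 ^+ 2 - (x ^+ 2 - 1) * (cheb d x).2 ^+ 2 = 1.
Proof.
elim: d => [|d] /=; first by ring.
by case: (cheb d x) => t u /= E; rewrite -[RHS]E; ring.
Qed.

(** For [x ^ 2 <= 1] both summands in Pell's equation are nonnegative. *)
Lemma cheb_le1 d x : `|x| <= 1 -> `|(cheb d x).1| <= 1.
Proof.
move=> x1; rewrite -(@expr_le1 _ 2) // ?normr_ge0 // real_normK ?num_real //.
rewrite -(cheb_pell d x) -subr_ge0.
suff : 0 <= (1 - x ^+ 2) * (cheb d x).2 ^+ 2 by lra.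
apply: mulr_ge0; last exact: sqr_ge0.
by rewrite subr_ge0 -real_normK ?num_real // expr_le1.
Qed.

(** The slope of [T_d] at 1 is [d ^ 2]; the two bounds feed each other in the induction. *)
Lemma cheb_growth d x : 1 <= x ->
  1 + d%:R ^+ 2 * (x - 1) <= (cheb d x).1 /\ d%:R <= (cheb d x).2.
Proof.
move=> x1; elim: d => [|d] /=; first by split; lra.
case: (cheb d x) => t u /= [ht hu].
have d0 : 0 <= d%:R :> R by rewrite ler0n.
rewrite -natr1; move: d%:R d0 hu ht => e d0 hu ht.
have h1 : 0 <= x * (t - (1 + e ^+ 2 * (x - 1))) by apply: mulr_ge0; lra.
have h2 : 0 <= (x - 1) * (x + 1) * (u - e) by apply: mulr_ge0; [apply: mulr_ge0|]; lra.
have h3 : 0 <= (x - 1) ^+ 2 * e by apply: mulr_ge0; first exact: sqr_ge0.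
have h4 : 0 <= (x - 1) ^+ 2 * e ^+ 2 by apply: mulr_ge0; exact: sqr_ge0.
have h5 : 0 <= (x - 1) * (e ^+ 2) by apply: mulr_ge0; [lra|exact: sqr_ge0].
have h6 : 0 <= (x - 1) * (u - e) by apply: mulr_ge0; lra.
have h7 : 0 <= (x - 1) * e by apply: mulr_ge0; lra.
split; last by lra.
rewrite -subr_ge0.
suff -> : x * t + (x ^+ 2 - 1) * u - (1 + (e + 1) ^+ 2 * (x - 1)) =
  x * (t - (1 + e ^+ 2 * (x - 1))) + (x - 1) * (x + 1) * (u - e) +
  (x - 1) ^+ 2 * e + (x - 1) ^+ 2 * e ^+ 2 by rewrite !addr_ge0.
by ring.
Qed.

End Chebyshev.

(** Applied to evaluation, this reduces [cheb] at a polynomial to [cheb] at a real number. *)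
Lemma cheb_morph (A B : comNzRingType) (f : {rmorphism A -> B}) (d : nat) (x : A) :
  cheb d (f x) = (f (cheb d x).1, f (cheb d x).2).
Proof.
elim: d => [|d] /=; first by rewrite rmorph1 rmorph0.
case: (cheb d x) => t u /= ->.
by rewrite !rmorphD !rmorphM rmorphB rmorphXn rmorph1.
Qed.

(** * Approximate degree of a conjunction *)

Section ApproximateAnd.
Variables (R : realType) (N : nat).

Lemma msize_cheb (D d : nat) (p : mpoly N R) :
  (msize p <= D.+1)%N -> (msize (cheb d p).1 <= (d * D).+1)%N.
Proof.
move=> hp.
(* The second component really has degree [(d - 1) * D]; the bound on its product with [p] records
   this without subtraction. *)
suff : [/\ msize (cheb d p).1 <= (d * D).+1, msize (cheb d p).2 <= (d * D).+1
         & msize (p * (cheb d p).2) <= (d * D).+1]%N by case.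
elim: d => [|d] /=; first by rewrite mulr0 msize0 msize1.
case: (cheb d p) => t u /= [ht hu hpu].
have w (q : mpoly N R) : (msize q <= (d * D).+1 -> msize q <= (d.+1 * D).+1)%N.
  by move=> hq; apply: leq_trans hq _; rewrite ltnS leq_mul2r leqnSn orbT.
have htu := msize_add ht hpu.
have mulp q : (msize q <= (d * D).+1 -> msize (p * q) <= (d.+1 * D).+1)%N.
  by rewrite mulSn; apply: msize_mul.
split; [|exact: w|exact: mulp].
rewrite mulrBl mul1r expr2 -mulrA; apply: msize_add; first exact: mulp.
by apply: msize_add; [exact: mulp|rewrite msizeN w].
Qed.

(** With [M] tests, [(1 + number of passed tests) / M] lies in [[0, 1]] unless all pass, when it is
    [1 + 1 / M]. At that point [T_d] has a value [c >= 3], so [T_d / c] is 1 there and at most 1/3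
    in absolute value otherwise. *)
Lemma approx_deg_forall (O : finType) (g : O -> bits N -> bool) (D d : nat) :
  (0 < #|O|)%N -> (2 * #|O| <= d ^ 2)%N -> (forall o, exact_deg R D (g o)) ->
  (approx_deg R (fun x => [forall o, g o x]) <= d * D)%N.
Proof.
move=> O0 hd /choice [P HP].
set M : R := #|O|%:R.
have M0 : 0 < M by rewrite ltr0n.
pose q : mpoly N R := M^-1 *: (\sum_o P o + 1).
have hq : (msize q <= D.+1)%N.
  apply: leq_trans (msizeZ_le _ _) _; apply: msize_add; last by rewrite msize1.
  by apply: msize_bigsum => o; case: (HP o).
pose c : R := (cheb d (1 + M^-1)).1.
have c3 : 3%:R <= c.
  have M1 : 1 <= 1 + M^-1 by rewrite lerDl invr_ge0 ltW.
  apply: le_trans (cheb_growth d M1).1; rewrite [1 + M^-1]addrC addrK.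
  have : 2%:R <= d%:R ^+ 2 / M.
    by rewrite ler_pdivlMr // -natrX -natrM ler_nat.
  lra.
have qE x : bit_eval x q = (1 + #|[set o | g o x]%SET|%:R) / M.
  rewrite /bit_eval /q mevalZ rmorphD /= meval1 raddf_sum mulrC addrC /=.
  congr (_ * _); congr (_ + _).
  rewrite (eq_bigr (fun o => (g o x)%:R)); last by move=> o _; exact: (HP o).2.
  rewrite -natr_sum -sum1dep_card; congr _%:R; rewrite [RHS]big_mkcond.
  by apply: eq_bigr => o _; case: (g o x).
pose p := c^-1 *: (cheb d q).1.
have pE x : bit_eval x p = (cheb d (bit_eval x q)).1 / c.
  by rewrite /bit_eval /p mevalZ mulrC; congr (_ / _); rewrite cheb_morph.
rewrite /approx_deg; case: ex_minnP => m _ /(_ (mdegree p)) Hm.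
have sp : (mdegree p <= d * D)%N.
  have := leq_trans (msizeZ_le (cheb d q).1 c^-1) (msize_cheb d hq).
  by rewrite /mdegree -/p; case: (mmeasure _ p).
apply: leq_trans sp; apply: Hm; apply/asboolP; exists p; split=> // x.
rewrite [meval _ _]pE qE.
have [/forallP H|] := boolP [forall o, g o x].
  have -> : [set o | g o x]%SET = [set: O]%SET by apply/setP => o; rewrite !inE H.
  rewrite cardsT -/M.
  have -> : (1 + M) / M = 1 + M^-1 by rewrite mulrDl mul1r divff ?gt_eqF // addrC.
  rewrite divff ?subrr ?normr0 ?divr_ge0 //; lra.
rewrite negb_forall => /existsP [o no].
rewrite subr0 normrM normfV (ger0_norm (_ : 0 <= c)); last by lra.
rewrite ler_pdivrMr; last by lra.
have le1 : `|(cheb d ((1 + #|[set o | g o x]%SET|%:R) / M)).1| <= 1.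
  apply: cheb_le1; rewrite ger0_norm; last by rewrite divr_ge0 // ltW // ltr_wpDr.
  rewrite ler_pdivrMr // mul1r addrC natr1 ler_nat -cardsT; apply: proper_card.
  by rewrite properT; apply/negP => /eqP/setP/(_ o); rewrite !inE (negbTE no).
lra.
Qed.

End ApproximateAnd.

(** * Random labels of a binary tree *)

Section LabelledTree.
Variable V : finType.

(* Binary trees of depth [s] whose non-root nodes carry labels in [V]. *)
Fixpoint ltree (s : nat) : finType :=
  if s is s'.+1 then ((V * ltree s') * (V * ltree s'))%type else unit.

Fixpoint label (v0 : V) (s : nat) : ltree s -> seq bool -> V :=
  if s is s'.+1 then fun t p =>
    match p with
    | [::] => v0
    | b :: p' => let u := if b then t.2 else t.1 in
                 if p' is [::] then u.1 else label v0 u.2 p'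
    end
  else fun _ _ => v0.

Variable P : pred V.

(* The paths all of whose nonempty prefixes have a label in [P]. *)
Fixpoint survivors (s : nat) : ltree s -> seq (seq bool) :=
  if s is s'.+1 then fun t =>
    [::] :: (if P t.1.1 then map (cons false) (survivors t.1.2) else [::]) ++
            (if P t.2.1 then map (cons true) (survivors t.2.2) else [::])
  else fun _ => [:: [::]].

Lemma survivors_root s (t : ltree s) : [::] \in survivors t.
Proof. by case: s t. Qed.

Lemma survivors_size s (t : ltree s) p : p \in survivors t -> (size p <= s)%N.
Proof.
elim: s t p => [|s IH] t p /=; first by rewrite inE => /eqP ->.
rewrite inE => /orP[/eqP -> //|]; rewrite mem_cat => /orP[]; case: (P _) => // /mapP[q Hq ->] /=;
  rewrite ltnS; exact: IH Hq.
Qed.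

Lemma survivors_closed v0 s (t : ltree s) p b :
  p \in survivors t -> (size p < s)%N -> P (label v0 t (rcons p b)) ->
  rcons p b \in survivors t.
Proof.
elim: s t p b => [|s IH] t p b //.
have inj c : injective (cons c : seq bool -> _) by move=> ? ? [].
case: p => [|c p] /=.
  by case: b => _ _ /= ->; rewrite inE /= mem_cat map_f ?survivors_root ?orbT.
rewrite inE /= mem_cat ltnS => H sp.
have {H} [Pc Hp] : P (if c then t.2 else t.1).1 /\ p \in survivors (if c then t.2 else t.1).2.
  case/orP: H; case: ifP => // Pu /mapP[q Hq [-> ->]] //.
have -> : (if rcons p b is [::] then (if c then t.2 else t.1).1
     else label v0 (if c then t.2 else t.1).2 (rcons p b)) =
    label v0 (if c then t.2 else t.1).2 (rcons p b) by case: (p).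
move=> /(IH _ _ b Hp sp) H; rewrite inE /= mem_cat.
by case: c Pc H {Hp} => /= -> H; rewrite map_f ?orbT.
Qed.

Definition weight s (t : ltree s) : nat := (2 ^ size (survivors t))%N.

(** The mean [E_s] of the weight satisfies [E_0 = 2] and [E_(s+1) = 2 * (q * E_s + 1 - q) ^ 2],
    where [q <= 1/16] is the density of [P]. Hence [E_s <= 4] implies
    [E_(s+1) <= 2 * (5/4) ^ 2 <= 4]. *)
Lemma sum_weight s : (16 * #|P| <= #|V| ->
  \sum_(t : ltree s) weight t <= 4 * #|{: ltree s}|)%N.
Proof.
move=> hP; elim: s => [|s IH] /=.
  by rewrite big_const card_unit iter_addn_0 /weight.
pose F (u : V * ltree s) : nat := if P u.1 then weight u.2 else 1%N.
have -> : (\sum_(t : ltree s.+1) weight t = 2 * ((\sum_u F u) * (\sum_u F u)))%N.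
  rewrite big_distrlr /= pair_bigA big_distrr /=; apply: eq_bigr => -[[v1 t1] [v2 t2]] _.
  rewrite /weight /F /= size_cat expnS expnD.
  by case: (P v1); case: (P v2); rewrite ?size_map.
have -> : (\sum_u F u = #|P| * (\sum_(t : ltree s) weight t) + (#|V| - #|P|) * #|{: ltree s}|)%N.
  rewrite -(pair_bigA _ (fun v t => F (v, t))) /= /F /= (bigID P) /=; congr (_ + _)%N.
    by rewrite (eq_bigr (fun=> \sum_(t : ltree s) weight t)%N) ?sum_nat_const // => v ->.
  rewrite (eq_bigr (fun=> #|{: ltree s}|)%N) => [|v /negbTE ->]; last by rewrite sum1_card.
  by rewrite sum_nat_const -(cardC P) addKn.
rewrite !card_prod.
have : (#|P| <= #|V|)%N := max_card _.
move: IH hP; set p := #|P|; set v := #|V|.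
set w := (\sum_(t : ltree s) weight t)%N; set c := #|{: ltree s}|.
move=> IH hP le.
have : (4 * (p * w + (v - p) * c) <= 5 * (v * c))%N by nia.
move: (_ + _)%N => S; nia.
Qed.

End LabelledTree.

Lemma card_ltree_gt0 (V : finType) (v0 : V) s : (0 < #|{: ltree V s}|)%N.
Proof.
elim: s => [|s IH] /=; first by rewrite card_unit.
by rewrite !card_prod !muln_gt0 IH !andbT andbb; apply/card_gt0P; exists v0.
Qed.

(* Union bound: a random tree has more than [m] survivors with probability at
   most [4 / 2 ^ m.+1] for each predicate. *)
Lemma exists_few_survivors (V I : finType) (P : I -> pred V) (v0 : V) (s m : nat) :
  (forall i, 16 * #|P i| <= #|V|)%N -> (4 * #|I| < 2 ^ m.+1)%N ->
  exists t : ltree V s, forall i, (size (survivors (P i) t) <= m)%N.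
Proof.
move=> hP hm.
have [/existsP[t /forallP H]|] :=
  boolP [exists t : ltree V s, [forall i, size (survivors (P i) t) <= m]%N].
  by exists t.
move/existsPn => H.
(* Markov's inequality by counting: if every tree were bad for some [i], the total weight over all
   trees and all [i] would contradict [sum_weight]. *)
have lo (t : ltree V s) : (2 ^ m.+1 <= \sum_i weight (P i) t)%N.
  have /forallPn[i Hi] := H t.
  by rewrite (bigD1 i) //= (leq_trans _ (leq_addr _ _)) // /weight leq_exp2l // ltnNge.
have : (#|{: ltree V s}| * 2 ^ m.+1 <= #|I| * (4 * #|{: ltree V s}|))%N.
  rewrite -[X in (X <= _)%N]sum_nat_const.
  apply: (@leq_trans (\sum_(t : ltree V s) \sum_i weight (P i) t)%N).
    by apply: leq_sum => t _; exact: lo.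
  rewrite exchange_big -[X in (_ <= X)%N]sum_nat_const; apply: leq_sum => i _.
  exact: sum_weight.
by rewrite mulnA mulnC leq_pmul2r ?(card_ltree_gt0 v0) // mulnC leqNgt hm.
Qed.

(** Four rows per label make the density of labels within [W] at most [(1/2) ^ 4 = 1/16], and
    [4 * 2 ^ n < 2 ^ (2 * n + 1)] pays for the union bound over [W]. The root heads [T] so that it
    will land in slot [t0]. *)
Lemma exists_labelling (n s : nat) : (1 < n)%N ->
  exists G : seq bool -> 'I_4 -> 'I_n, forall W : {set 'I_n}, (2 * #|W| <= n)%N ->
  exists T : seq (seq bool),
    [/\ (size T <= 2 * n)%N, [::] \in T /\ head [::] T = [::],
        (forall p, p \in T -> (size p <= s)%N)
      & forall p b, p \in T -> (size p < s)%N -> (forall j, G (rcons p b) j \in W) ->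
        rcons p b \in T].
Proof.
case: n => // n' n1; set n := n'.+1.
pose V : finType := {ffun 'I_4 -> 'I_n}.
(* For [W] with more than [n / 2] rows the predicate is empty, so the union bound may range over all
   sets. *)
pose P (W : {set 'I_n}) : pred V :=
  [pred v | (2 * #|W| <= n)%N && (v \in ffun_on (mem W))].
have hP W : (16 * #|P W| <= #|V|)%N.
  have [h|h] := leqP (2 * #|W|) n; last first.
    by rewrite eq_card0 ?muln0 // => v; rewrite inE /= leqNgt h.
  have -> : #|P W| = (#|W| ^ 4)%N.
    by rewrite -[in RHS](card_ord 4) -card_ffun_on; apply: eq_card => v; rewrite inE /= h.
  by rewrite card_ffun !card_ord (_ : 16%N = (2 ^ 4)%N) // -expnMn leq_exp2r.
have hI : (4 * #|{: {set 'I_n}}| < 2 ^ (2 * n).+1)%N.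
  rewrite -cardsT -powersetT card_powerset cardsT card_ord.
  by rewrite (_ : 4%N = (2 ^ 2)%N) // -expnD ltn_exp2l //; lia.
have [t Ht] := exists_few_survivors [ffun=> ord0 : 'I_n] s hP hI.
exists (fun p j => label [ffun=> ord0 : 'I_n] t p j) => W hW.
exists (survivors (P W) t); split=> [|||p b Hp sp HG].
- exact: Ht.
- by split; [exact: survivors_root|case: (s) t {Ht}].
- by move=> p; exact: survivors_size.
- apply: (survivors_closed (v0 := [ffun=> ord0 : 'I_n]) Hp sp).
  by rewrite /P /= hW; apply/ffun_onP.
Qed.

(** * The partial function *)

Section CertificateBounds.
Variable N : nat.
Implicit Types (f : partial_fun N) (x : bits N) (rho : passign N).

Lemma cert_at_ge (Sigma : {set option bool}) f x c : f x \in Sigma ->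
  (forall rho, is_cert Sigma f x rho -> (c <= psize rho)%N) -> (c <= cert_at Sigma f x)%N.
Proof.
move=> fx H; rewrite /cert_at; case: arg_minnP => [|rho Hrho _]; last exact: H.
exact: full_assign_is_cert.
Qed.

Lemma cert_at_le (Sigma : {set option bool}) f x rho :
  is_cert Sigma f x rho -> (cert_at Sigma f x <= psize rho)%N.
Proof.
move=> Hr; rewrite /cert_at; case: arg_minnP => [|r _ H]; last exact: H.
apply: full_assign_is_cert; case/andP: Hr => c /forallP/(_ x).
by rewrite c.
Qed.

Lemma cert_b_le b f c :
  (forall x, f x = Some b -> exists I : {set 'I_N}, (#|I| <= c)%N /\
     forall x' : bits N, {in I, forall i, x' i = x i} -> f x' = Some b) ->
  (cert_b b f <= c)%N.
Proof.
move=> H; apply/bigmax_leqP => x; rewrite inE => /eqP/H [I [cI HI]].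
pose rho : passign N := [ffun i => if i \in I then Some (x i) else None].
have hp : (psize rho <= c)%N.
  apply: (leq_trans _ cI); apply: subset_leq_card; apply/fintype.subsetP => i.
  by rewrite inE ffunE; case: (i \in I).
apply: (leq_trans _ hp); apply: cert_at_le; apply/andP; split.
  by apply/forallP => i; rewrite ffunE; case: (i \in I); rewrite ?eqxx.
apply/forallP => x'; apply/implyP => /forallP cx; rewrite inE; apply/eqP/HI => i iI.
by have := cx i; rewrite ffunE iI /= => /eqP[].
Qed.

Lemma psize_ge (T : finType) (v : T -> 'I_N) rho :
  injective v -> (forall t, rho (v t) != None) -> (#|T| <= psize rho)%N.
Proof.
move=> iv H; rewrite -cardsT -(card_imset _ iv); apply: subset_leq_card.
by apply/fintype.subsetP => i /imsetP[t _ ->]; rewrite inE.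
Qed.

End CertificateBounds.

Section Construction.
Variables (k n m N l : nat).
Hypotheses (k_gt1 : (1 < k)%N) (nE : n = (2 ^ k)%N) (mE : m = (2 * n)%N).

(* A variable for each leaf of the binary tree of depth [2 * k] (junk on other
   paths), and a variable for each cell of an [n] by [n] grid. *)
Variables (varA : seq bool -> 'I_N) (varB : 'I_n * 'I_n -> 'I_N).
Hypotheses (varA_inj : forall p q, size p = (2 * k)%N -> size q = (2 * k)%N ->
              varA p = varA q -> p = q)
           (varB_inj : injective varB) (varAB : forall p gh, varA p != varB gh).

(* A descriptor is a table with [m] slots, each holding a path, a column of the
   grid and a pointer to a slot for either child of the path. *)
Definition slot_type : finType := ((2 * k).-bseq bool * 'I_n * 'I_m * 'I_m)%type.
Definition path_of (s : slot_type) : seq bool := s.1.1.1.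
Definition column_of (s : slot_type) : 'I_n := s.1.1.2.
Definition child_slot (s : slot_type) (b : bool) : 'I_m := if b then s.2 else s.1.2.

Variables (slot : bits l -> 'I_m -> slot_type) (t0 : 'I_m).
Hypothesis slot_surj : forall s : 'I_m -> slot_type, exists y, slot y =1 s.
Hypothesis t0E : val t0 = 0%N.

Variable G : seq bool -> 'I_4 -> 'I_n.
Hypothesis G_few_survivors :
  forall W : {set 'I_n}, (2 * #|W| <= n)%N ->
  exists T : seq (seq bool),
    [/\ (size T <= 2 * n)%N, [::] \in T /\ head [::] T = [::],
        (forall p, p \in T -> (size p <= 2 * k)%N)
      & forall p b, p \in T -> (size p < 2 * k)%N -> (forall j, G (rcons p b) j \in W) ->
        rcons p b \in T].

Implicit Types (x : bits N) (y : bits l) (b : bool).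

Definition leaf_index : finType := option ('I_(2 * k) * 'I_4 * 'I_n).

Definition check1 (o : leaf_index) x y : bool :=
  let p := path_of (slot y t0) in
  if o is Some (s, j, h) then ~~ x (varB (G (take s.+1 p) j, h))
  else (size p == 2 * k)%N && x (varA p).

Definition node_check (h : 'I_n) (p q0 q1 : seq bool) x : bool :=
  if size p == (2 * k)%N then ~~ x (varA p)
  else [forall b : bool, ((if b then q1 else q0) == rcons p b) ||
          [exists j, x (varB (G (rcons p b) j, h))]].

(** The column is always read in slot [t0], so that all nodes are tested in the same one. Following
    pointers instead of searching the table for the children keeps the test local. *)
Definition check0 (o : option 'I_m) x y : bool :=
  if o is Some t then
    node_check (column_of (slot y t0)) (path_of (slot y t))
      (path_of (slot y (child_slot (slot y t) false)))
      (path_of (slot y (child_slot (slot y t) true))) x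
  else path_of (slot y t0) == [::].

Definition phi b x y : bool :=
  if b then [forall o, check1 o x y] else [forall o, check0 o x y].

Definition pfun : partial_fun N := fun x =>
  if [exists y, phi true x y] then Some true
  else if [exists y, phi false x y] then Some false else None.

Lemma check0_child x y t b : check0 (Some t) x y ->
  (size (path_of (slot y t)) < 2 * k)%N ->
  (forall j, ~~ x (varB (G (rcons (path_of (slot y t)) b) j, column_of (slot y t0)))) ->
  exists t', path_of (slot y t') = rcons (path_of (slot y t)) b.
Proof.
rewrite /check0 /node_check => H sp Hx; move: H; rewrite ltn_eqF // => /forallP/(_ b)/orP[].
  by case: b Hx => _ /eqP <-; [exists (child_slot (slot y t) true)|
    exists (child_slot (slot y t) false)].
by case/existsP => j Hj; rewrite (negbTE (Hx j)) in Hj.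
Qed.

(** From the root slot on, the zeros along the path to [e] force each next prefix of [e] into the
    table; at [e] itself the leaf variable would have to be both 0 and 1. *)
Lemma phi_disjoint x y y' : phi true x y' -> ~~ phi false x y.
Proof.
move=> /forallP H1; apply/negP => /forallP H0.
have /andP[/eqP se xe] := H1 None.
set e := path_of (slot y' t0) in se xe.
have walk s : (s <= 2 * k)%N -> exists t, path_of (slot y t) = take s e.
  elim: s => [|s IH] hs; first by exists t0; rewrite take0; exact/eqP/(H0 None).
  have [t pt] := IH (ltnW hs).
  rewrite (take_nth false) ?se // -pt; apply: check0_child (H0 (Some t)) _ _.
    by rewrite pt size_take se hs.
  move=> j; rewrite pt -take_nth ?se //.
  exact: (H1 (Some (Ordinal hs, j, column_of (slot y t0)))).
have [t pt] := walk (2 * k)%N (leqnn _).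
rewrite -se take_size in pt.
by have := H0 (Some t); rewrite /check0 /node_check pt se eqxx xe.
Qed.

Lemma pfunP b x : pfun x = Some b <-> exists y, phi b x y.
Proof.
rewrite /pfun; split.
  by case: existsP => [[y Hy] [<-]|_]; [|case: existsP => [[y Hy] [<-]|]]; try by exists y.
case=> y Hy; have [/existsP[y1 H1]|no] := boolP [exists y, phi true x y].
  by case: b Hy => // Hy; have := phi_disjoint y H1; rewrite Hy.
case: b Hy => Hy; first by case/existsP: no; exists y.
by rewrite ifT //; apply/existsP; exists y.
Qed.

Definition zero_input : bits N := [ffun=> false].

(** A descriptor for the value 0 would have to list all nodes, but [n ^ 2] leaves do not fit into
    [2 * n] slots when [n > 2]. *)
Lemma pfun_zero_input : pfun zero_input = None.
Proof.
rewrite /pfun; case: existsP => [[y /forallP/(_ None)]|_].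
  by rewrite /= ffunE andbF.
case: existsP => // -[y /forallP H]; exfalso.
have all_paths p : (size p <= 2 * k)%N -> exists t, path_of (slot y t) = p.
  elim/last_ind: p => [|p b IH]; first by exists t0; exact/eqP/(H None).
  rewrite size_rcons => sp; have [t pt] := IH (ltnW sp).
  rewrite -pt; apply: check0_child (H (Some t)) _ _; first by rewrite pt.
  by move=> j; rewrite ffunE.
have /choice [F HF] : forall e : (2 * k).-tuple bool, exists t, path_of (slot y t) = e.
  by move=> e; apply: all_paths; rewrite size_tuple.
have iF : injective F by move=> e e' E; apply: val_inj; rewrite /= -(HF e) E HF.
have := leq_card F iF.
rewrite card_tuple card_bool card_ord mE mulnC expnM -nE leq_pmul2r ?nE ?expn_gt0 //.
by rewrite leqNgt -{1}(expn1 2) ltn_exp2l // k_gt1.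
Qed.

Lemma phi0_complete (h : 'I_n) (W : {set 'I_n}) x : (2 * #|W| <= n)%N ->
  (forall p, ~~ x (varA p)) -> (forall g, g \notin W -> x (varB (g, h))) ->
  exists y, phi false x y.
Proof.
move=> /G_few_survivors [T [sT [T0 hT] HT cT]] xA xB.
pose bs p : (2 * k).-bseq bool := insubd [bseq] p.
have bsE p : (size p <= 2 * k)%N -> val (bs p) = p by move=> sp; rewrite val_insubd sp.
(* Slots beyond the end of [T] repeat the root, which lies in [T]. *)
pose at_ (t : 'I_m) := nth [::] T t.
have atT t : at_ t \in T.
  by rewrite /at_; have [lt|ge] := ltnP t (size T); [exact: mem_nth|rewrite nth_default].
(* A child outside [T] gets a meaningless pointer; its test then passes because one of its rows lies
   outside [W], where column [h] is 1. *)
pose ptr p : 'I_m := insubd t0 (index p T).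
have ptrE p : p \in T -> at_ (ptr p) = p.
  move=> pT; rewrite /at_ /ptr val_insubd ifT ?nth_index //.
  by rewrite mE; apply: leq_trans sT; rewrite index_mem.
have [y Hy] := slot_surj
  (fun t => (bs (at_ t), h, ptr (rcons (at_ t) false), ptr (rcons (at_ t) true))).
have py t : path_of (slot y t) = at_ t by rewrite Hy /path_of /= [LHS]bsE ?HT.
exists y; apply/forallP => -[t|] /=; last by rewrite py /at_ t0E nth0 hT.
rewrite /node_check !py; case: eqP => // /eqP ne; apply/forallP => b.
have sp : (size (at_ t) < 2 * k)%N by rewrite ltn_neqAle ne HT.
apply/orP; have [|/existsPn Hj] :=
  boolP [exists j, x (varB (G (rcons (at_ t) b) j, column_of (slot y t0)))]; first by right.
left; apply/eqP.
have : rcons (at_ t) b \in T.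
  apply: (cT _ _ (atT t) sp) => j; apply: contraR (Hj j) => /xB.
  by rewrite Hy.
by move/ptrE => E; case: b E {Hj} => E; rewrite Hy.
Qed.

Definition descriptor_set b y : {set 'I_N} :=
  if b then
    [set (if o is Some (s, j, h) then varB (G (take s.+1 (path_of (slot y t0))) j, h)
          else varA (path_of (slot y t0))) | o : leaf_index]
  else
    [set (if u.2 is Some (c, j) then
            varB (G (rcons (path_of (slot y u.1)) c) j, column_of (slot y t0))
          else varA (path_of (slot y u.1))) | u : 'I_m * option (bool * 'I_4)].

(** The value 1 takes at most [8 * n * k + 1] coordinates; for the value 0, each of the [2 * n]
    slots contributes one leaf variable and eight cells. *)
Lemma card_descriptor_set b y : (#|descriptor_set b y| <= 18 * (n * k))%N.
Proof.
case: b; (apply: leq_trans (leq_imset_card _ _) _; rewrite cardT -cardE).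
  rewrite card_option !card_prod !card_ord; have : (0 < n)%N by rewrite nE expn_gt0.
  by move: k_gt1; nia.
rewrite card_prod card_option card_prod card_bool !card_ord mE; move: k_gt1; nia.
Qed.

Lemma phi_persistent b y x x' : phi b x y ->
  {in descriptor_set b y, forall i, x' i = x i} -> phi b x' y.
Proof.
case: b => /forallP H E; apply/forallP => o; have := H o.
  case: o => [[[s j] h]|] /=.
    by rewrite E //; apply/imsetP; exists (Some (s, j, h)).
  by rewrite E //; apply/imsetP; exists None.
case: o => // t /=; rewrite /node_check; case: ifP => _.
  by rewrite E //; apply/imsetP; exists (t, None).
move=> /forallP Hb; apply/forallP => b; case/orP: (Hb b) => [->//|/existsP[j Hj]].
apply/orP; right; apply/existsP; exists j; rewrite E //.
by apply/imsetP; exists (t, Some (b, j)).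
Qed.

Lemma pfun_cert_le : (cert pfun <= 18 * (n * k))%N.
Proof.
suff H b : (cert_b b pfun <= 18 * (n * k))%N by rewrite /cert geq_max !H.
apply: cert_b_le => x /pfunP [y Hy]; exists (descriptor_set b y).
split; first exact: card_descriptor_set.
by move=> x' /(phi_persistent Hy) Hy'; apply/pfunP; exists y.
Qed.

Definition leaf_input (e : seq bool) : bits N := [ffun i => i == varA e].

Lemma exists_leaf_slot (e : seq bool) : size e = (2 * k)%N ->
  exists y, path_of (slot y t0) = e.
Proof.
move=> se; have h0 : 'I_n by rewrite nE; exact: (Ordinal (expn_gt0 2 k)).
have [y Hy] := slot_surj (fun=> (insubd [bseq] e, h0, t0, t0)).
by exists y; rewrite Hy /path_of /= val_insubd se leqnn.
Qed.

Lemma pfun_leaf_input e : size e = (2 * k)%N -> pfun (leaf_input e) = Some true.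
Proof.
move=> se; have [y Hy] := exists_leaf_slot se.
apply/pfunP; exists y; apply/forallP => -[[[s j] h]|] /=; rewrite Hy ffunE.
  by rewrite eq_sym varAB.
by rewrite se !eqxx.
Qed.

(** If [e] is the only leaf with variable 1, then a single 1 in a row labelling its path destroys
    the value 1. A certificate must thus fix all [n] cells of such a row. *)
Lemma pfun_cert_ge : (n <= cert pfun)%N.
Proof.
pose e := nseq (2 * k) false; have se : size e = (2 * k)%N by rewrite size_nseq.
rewrite leq_max; apply/orP; right; rewrite /cert_b /cert_set.
apply: leq_trans (leq_bigmax_cond (leaf_input e) _); last by rewrite inE pfun_leaf_input.
apply: cert_at_ge => [|rho /andP[cx /forallP H]]; first by rewrite inE pfun_leaf_input.
pose v h := varB (G (take 1 e) ord0, h).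
rewrite -[n]card_ord; apply: (@psize_ge _ _ v) => [h h' /varB_inj [] //|h].
apply/negP => /eqP rh.
pose x' : bits N := [ffun i => (i == varA e) || (i == v h)].
have : pfun x' \in [set Some true]%SET.
  apply: (implyP (H x')); apply/forallP => i; apply/implyP => ri.
  have ni : i != v h by apply: contraNneq ri => ->; rewrite rh.
  have := forallP cx i; rewrite ri /= => /eqP ->.
  by rewrite !ffunE (negbTE ni) orbF.
rewrite inE => /eqP /pfunP [y /forallP Hy].
have /andP[/eqP sp] := Hy None; rewrite ffunE /v (negbTE (varAB _ _)) orbF => /eqP pe.
have {}pe := varA_inj sp se pe.
have k2 : (0 < 2 * k)%N by move: k_gt1; lia.
by have := Hy (Some (Ordinal k2, ord0, h)); rewrite /check1 pe ffunE eqxx orbT.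
Qed.

(** Switching on one free leaf variable would give a 1-input, so all [n ^ 2] of them are fixed. *)
Lemma pfun_cert_not1 : (n * n <= cert_not_at true pfun zero_input)%N.
Proof.
apply: cert_at_ge => [|rho /andP[cz /forallP H]]; first by rewrite pfun_zero_input !inE.
pose v (e : (2 * k).-tuple bool) := varA e.
have -> : (n * n = #|{: (2 * k).-tuple bool}|)%N.
  by rewrite card_tuple card_bool nE -expnD addnn mul2n.
apply: (@psize_ge _ _ v) => [e e' /varA_inj E|e].
  by apply: val_inj; apply: E; rewrite size_tuple.
apply/negP => /eqP re.
have : pfun (leaf_input e) \in [set Some (~~ true); None]%SET.
  apply: (implyP (H _)); apply/forallP => i; apply/implyP => ri.
  have := forallP cz i; rewrite ri /= => /eqP ->; rewrite !ffunE.
  by rewrite (_ : i == varA e = false) //; apply: contraNF ri => /eqP ->; rewrite -/(v e) re.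
by rewrite pfun_leaf_input ?size_tuple // !inE.
Qed.

Lemma pfun_cert_not0 : (n * n <= 2 * cert_not_at false pfun zero_input)%N.
Proof.
have half c d : (c <= 2 * d)%N = (uphalf c <= d)%N by lia.
rewrite half; apply: cert_at_ge => [|rho /andP[cz /forallP H]]; first by rewrite pfun_zero_input !inE.
rewrite -half leqNgt; apply/negP => small.
pose W h := [set g | rho (varB (g, h)) != None]%SET.
(* Averaging over columns: fewer than [n ^ 2 / 2] coordinates are fixed. *)
have [h Wh] : exists h, (2 * #|W h| <= n)%N.
  apply/existsP; apply: contraLR small => /existsPn big; rewrite -leqNgt.
  have -> : (n * n = \sum_(h < n) n)%N by rewrite sum_nat_const card_ord.
  apply: (@leq_trans (\sum_(h < n) (2 * #|W h|))%N).
    by apply: leq_sum => h _; have := big h; rewrite -ltnNge => /ltnW.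
  rewrite -big_distrr leq_mul2l /=.
  under eq_bigr => h _ do rewrite -sum1dep_card.
  rewrite (exchange_big_dep predT) //= pair_big_dep /= sum1dep_card.
  rewrite -(card_imset _ varB_inj); apply: subset_leq_card.
  by apply/fintype.subsetP => i /imsetP[[g h]]; rewrite inE /= => gh ->; rewrite inE.
(* All free grid cells become 1, in every column; the leaf variables stay 0. *)
pose x : bits N := [ffun i => (rho i == None) && [exists gh, i == varB gh]].
have [||y Hy] := @phi0_complete h (W h) x Wh.
- move=> p; rewrite ffunE negb_and; apply/orP; right; apply/existsPn => gh.
  exact: varAB.
- move=> g; rewrite inE negbK ffunE => ->; apply/existsP; by exists (g, h).
have : pfun x \in [set Some (~~ false); None]%SET.
  apply: (implyP (H x)); apply/forallP => i; apply/implyP => ri.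
  have := forallP cz i; rewrite ri /= => /eqP ->; rewrite !ffunE.
  by case: (rho i) ri.
by have /pfunP -> : exists y, phi false x y; [exists y|rewrite !inE].
Qed.

(** * Degrees of the tests and of the two predicates *)

Section Degree.
Variables (R : realType) (d : nat).

Definition input_part (w : bits (N + l)) : bits N := [ffun i => w (lshift l i)].
Definition descriptor_part (w : bits (N + l)) : bits l := [ffun j => w (rshift N j)].

Hypothesis slot_deg : forall t, query_deg R d (fun w => slot (descriptor_part w) t).

Lemma check1_deg o : exact_deg R (4 * d + 8) (fun w => check1 o (input_part w) (descriptor_part w)).
Proof.
apply: (@exact_deg_leq _ _ (d + 1)); first lia.
pose F (s : slot_type) (w : bits (N + l)) : bool :=
  if o is Some (i, j, h) then ~~ w (lshift l (varB (G (take i.+1 (path_of s)) j, h)))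
  else (size (path_of s) == 2 * k)%N && w (lshift l (varA (path_of s))).
apply: (@exact_deg_ext _ _ _ (fun w => F (slot (descriptor_part w) t0) w)) => [w|].
  by rewrite /F /check1; clear F; case: o => [[[i j] h]|]; rewrite ffunE.
apply: exact_deg_bind => // s; rewrite /F; clear F; case: o => [[[i j] h]|].
  pose f (_ : unit) := lshift l (varB (G (take i.+1 (path_of s)) j, h)).
  apply: (@exact_deg_ext _ _ _ (fun w : bits (N + l) => ~~ [ffun u => w (f u)] tt)) => [w|].
    by rewrite ffunE.
  by apply: (exact_deg_junta R f (fun u => ~~ u tt)); rewrite card_unit.
pose f (_ : unit) := lshift l (varA (path_of s)).
apply: (@exact_deg_ext _ _ _ (fun w : bits (N + l) =>
   (size (path_of s) == 2 * k)%N && [ffun u => w (f u)] tt)) => [w|]; first by rewrite ffunE.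
by apply: (exact_deg_junta R f (fun u => (size (path_of s) == 2 * k)%N && u tt)); rewrite card_unit.
Qed.

Lemma node_check_deg h p q0 q1 :
  exact_deg R 8 (fun w => node_check h p q0 q1 (input_part w)).
Proof.
rewrite /node_check; case: (size p == (2 * k)%N).
  pose f (_ : unit) := lshift l (varA p).
  apply: (@exact_deg_ext _ _ _ (fun w : bits (N + l) => ~~ [ffun u => w (f u)] tt)) => [w|].
    by rewrite !ffunE.
  by apply: (exact_deg_junta R f (fun u => ~~ u tt)); rewrite card_unit.
pose f (u : bool * 'I_4) := lshift l (varB (G (rcons p u.1) u.2, h)).
pose P (u : {ffun bool * 'I_4 -> bool}) :=
  [forall b, ((if b then q1 else q0) == rcons p b) || [exists j, u (b, j)]].
apply: (@exact_deg_ext _ _ _ (fun w => P [ffun u => w (f u)])) => [w|].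
  by apply: eq_forallb => b; congr (_ || _); apply: eq_existsb => j; rewrite !ffunE.
by apply: exact_deg_junta; rewrite card_prod card_bool card_ord.
Qed.

(** Four slots are read adaptively: [t0] for the column, [t], and the two slots it points to. Then
    come at most eight cells, four rows for each child. *)
Lemma check0_deg o : exact_deg R (4 * d + 8) (fun w => check0 o (input_part w) (descriptor_part w)).
Proof.
case: o => [t|]; last first.
  apply: (@exact_deg_leq _ _ (d + 0)); first lia.
  apply: (exact_deg_bind (F := fun s _ => path_of s == [::]) (slot_deg t0)) => s.
  exact: exact_deg_const.
have -> : (4 * d + 8 = d + (d + (d + (d + 8))))%N by lia.
pose F3 s0 s q0 s1 w := node_check (column_of s0) (path_of s) q0 (path_of s1) (input_part w).
pose F2 s0 s s1 w := F3 s0 s (path_of s1) (slot (descriptor_part w) (child_slot s true)) w.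
pose F1 s0 s w := F2 s0 s (slot (descriptor_part w) (child_slot s false)) w.
pose F0 s0 w := F1 s0 (slot (descriptor_part w) t) w.
apply: (exact_deg_bind (F := F0) (slot_deg t0)) => s0.
apply: (exact_deg_bind (F := F1 s0) (slot_deg t)) => s.
apply: (exact_deg_bind (F := F2 s0 s) (slot_deg _)) => s1.
apply: (exact_deg_bind (F := F3 s0 s (path_of s1)) (slot_deg _)) => s2.
exact: node_check_deg.
Qed.

Lemma phi_approx_deg b c : (18 * (n * k) <= c ^ 2)%N ->
  (approx_deg R (joint (phi b)) <= c * (4 * d + 8))%N.
Proof.
move=> hc; have n0 : (0 < n)%N by rewrite nE expn_gt0.
case: b.
  apply: (approx_deg_forall _ _ check1_deg); first by apply/card_gt0P; exists None.
  rewrite card_option !card_prod !card_ord; move: k_gt1 hc n0; move: (c ^ 2)%N => C; nia.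
apply: (approx_deg_forall _ _ check0_deg); first by apply/card_gt0P; exists None.
rewrite card_option card_ord mE; move: k_gt1 hc n0; move: (c ^ 2)%N => C; nia.
Qed.

End Degree.
End Construction.

(** * Encoding of inputs and descriptors, and choice of constants *)

Lemma exists_bijection_ord (T : finType) (N : nat) : #|T| = N ->
  exists (v : T -> 'I_N) (u : 'I_N -> T), cancel v u /\ cancel u v.
Proof.
by move=> <-; exists (@enum_rank T), (@enum_val T T); split; [exact: enum_rankK|exact: enum_valK].
Qed.

Lemma exists_decoding (V : finType) (v0 : V) (w : nat) : (#|V| <= 2 ^ w)%N ->
  exists dec : {ffun 'I_w -> bool} -> V, forall v, exists u, dec u = v.
Proof.
move=> le; exists (fun u => nth v0 (enum V) (enum_rank u)) => v.
have lt : (enum_rank v < #|{: {ffun 'I_w -> bool}}|)%N.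
  by rewrite card_ffun card_bool card_ord; apply: leq_trans le.
by exists (enum_val (Ordinal lt)); rewrite enum_valK /= nth_enum_rank.
Qed.

Lemma card_bseq_bool_le (n : nat) : (#|{: n.-bseq bool}| <= 2 ^ n.+1)%N.
Proof.
rewrite (bij_eq_card bseq_tagged_tuple_bij) card_tagged sumnE big_map big_enum /=.
under eq_bigr => i _ do rewrite card_tuple card_bool.
by have := predn_exp 2 n.+1; rewrite mul1n => <-; exact: leq_pred.
Qed.

Theorem theorem3p1 (R : realType) :
  exists (n0 : nat) (KC cl Kl KI Kd : R) (e : nat) (eps : nat -> R),
    0 < cl /\ eps @ \oo --> (0 : R) /\
    forall n k : nat, n = (2 ^ k)%N -> (n0 <= n)%N ->
    let N := (2 * n ^ 2)%N in
    let nlogn : R := n%:R * k%:R in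
    exists (f : partial_fun N) (z : bits N) (l : nat)
           (phi : bool -> bits N -> bits l -> bool),
      f z = None /\ cl * nlogn <= l%:R <= Kl * nlogn /\
      (n%:R <= (cert f)%:R :> R /\ (cert f)%:R <= KC * nlogn /\
       n%:R * (n%:R - 1) / 2%:R <= (cert_not_at true f z)%:R :> R /\
       (1 / 2%:R + eps n) * n%:R ^+ 2 <= (cert_not_at false f z)%:R) /\
      (forall (b : bool) (x : bits N),
         f x = Some b <-> exists y : bits l, phi b x y) /\
      (exists I : bool -> bits l -> {set 'I_N},
         forall (b : bool) (y : bits l),
           (#|I b y|)%:R <= KI * nlogn /\
           forall x : bits N, phi b x y ->
           forall x' : bits N, {in I b y, forall i, x' i = x i} -> phi b x' y) /\
      (forall b : bool,
         (approx_deg R (joint (phi b)))%:R <= Kd * Num.sqrt n%:R * k%:R ^+ e).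
Proof.
(* The length [l = 2 * n * (5 * k + 3)] lies between [10 * n * k] and [16 * n * k]; 18 comes from
   [card_descriptor_set]; 300 is 150 from the degree count times 2 from [r <= 2 * sqrt n]. The error
   term is 0, as [n ^ 2 / 2] is reached exactly. *)
exists 4%N, 18%:R, 10%:R, 16%:R, 18%:R, 300%:R, 2%N, (fun=> 0).
split; first by rewrite ltr0n.
split; first exact: cvg_cst.
move=> n k nE n4 N nlogn.
have k_gt1 : (1 < k)%N by rewrite -(@ltn_exp2l 2) // -nE; apply: leq_trans n4.
have n_gt1 : (1 < n)%N by apply: leq_trans n4.
have nlognE : nlogn = (n * k)%:R by rewrite natrM.
(* A slot takes [2 * k + 1] bits for the path, [k] for the column and [k + 1] for each pointer. *)
pose m := (2 * n)%N; pose w := (5 * k + 3)%N; pose l := (m * w)%N.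
have [v [v' [vK v'K]]] : exists (v : (2 * k).-tuple bool + 'I_n * 'I_n -> 'I_N) v',
    cancel v v' /\ cancel v' v.
  apply: exists_bijection_ord.
  rewrite card_sum card_tuple card_prod !card_ord card_bool.
  by rewrite (_ : 2 ^ (2 * k) = n * n)%N; [rewrite /N mul2n mulnn addnn|rewrite nE -expnD addnn mul2n].
have [u [u' [uK _]]] : exists (u : 'I_m * 'I_w -> 'I_l) u', cancel u u' /\ cancel u' u.
  by apply: exists_bijection_ord; rewrite card_prod !card_ord.
have m_gt0 : (0 < m)%N by rewrite /m; lia.
pose t0 : 'I_m := Ordinal m_gt0.
pose i0 : 'I_n := Ordinal (ltnW n_gt1).
have [dec decE] : exists dec : {ffun 'I_w -> bool} -> slot_type k n m,
    forall s, exists c, dec c = s.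
  apply: (exists_decoding ([bseq], i0, t0, t0)).
  rewrite !card_prod !card_ord.
  have -> : (2 ^ w = 2 ^ (2 * k).+1 * n * m * m)%N.
    rewrite /m nE -!expnS -!expnD; congr (2 ^ _)%N; rewrite /w; lia.
  by rewrite !leq_mul ?card_bseq_bool_le.
pose pad : seq bool -> (2 * k).-tuple bool := insubd [tuple of nseq (2 * k) false].
have padE p : size p = (2 * k)%N -> val (pad p) = p by move=> sp; rewrite val_insubd sp eqxx.
pose varA p := v (inl (pad p)); pose varB gh := v (inr gh).
have varA_inj p q : size p = (2 * k)%N -> size q = (2 * k)%N -> varA p = varA q -> p = q.
  by move=> sp sq /(can_inj vK) [E]; rewrite -(padE p sp) E padE.
have varB_inj : injective varB by move=> a b /(can_inj vK) [].
have varAB p gh : varA p != varB gh by apply/eqP => /(can_inj vK).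
pose slot (y : bits l) (t : 'I_m) := dec [ffun i => y (u (t, i))].
have slot_surj (s : 'I_m -> slot_type k n m) : exists y, slot y =1 s.
  have /choice [c cE] : forall t, exists c, dec c = s t by move=> t; exact: decE.
  exists [ffun j => c (u' j).1 (u' j).2] => t; rewrite /slot -cE; congr dec.
  by apply/ffunP => i; rewrite !ffunE uK.
have slot_deg t : query_deg R w (fun x : bits (N + l) => slot (descriptor_part x) t).
  have q := query_deg_read R (fun i : 'I_w => rshift N (u (t, i))).
  rewrite card_ord in q; have := query_deg_map dec q; congr query_deg.
  by apply/funext => x; congr dec; apply/ffunP => i; rewrite !ffunE.
have [G HG] := exists_labelling (2 * k) n_gt1.
exists (pfun varA varB slot t0 G), (zero_input N), l, (phi varA varB slot t0 G).
split; first exact: (pfun_zero_input k_gt1).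
split; first by rewrite nlognE -!natrM !ler_nat /l /m /w; apply/andP; split; nia.
split.
  split; first by rewrite ler_nat; apply: (pfun_cert_ge k_gt1).
  split; first by rewrite nlognE -natrM ler_nat; apply: (pfun_cert_le k_gt1).
  have h1 : (n * n <= cert_not_at true (pfun varA varB slot t0 G) (zero_input N))%N.
    exact: (pfun_cert_not1 k_gt1).
  have h0 : (n * n <= 2 * cert_not_at false (pfun varA varB slot t0 G) (zero_input N))%N.
    exact: (pfun_cert_not0 k_gt1).
  move: h1 h0; rewrite -!(ler_nat R) !natrM.
  have : 0 <= n%:R :> R by rewrite ler0n.
  by split; nra.
split; first by move=> b x; apply: pfunP.
split.
  exists (descriptor_set varA varB slot t0 G) => b y; split.
    by rewrite nlognE -natrM ler_nat; apply: (card_descriptor_set k_gt1).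
  by move=> x Hx x'; apply: phi_persistent.
(* The square root of [n], rounded up to a power of two since [k] may be odd. *)
move=> b; pose r := (2 ^ uphalf k)%N.
have r_lo : (n <= r ^ 2)%N by rewrite nE -expnM leq_exp2l //; lia.
have r_hi : (r ^ 2 <= 2 * n)%N by rewrite nE -expnM -expnS leq_exp2l //; lia.
have hc : (18 * (n * k) <= (5 * k * r) ^ 2)%N.
  by rewrite expnMn; move: (r ^ 2)%N r_lo => r2 r_lo; nia.
have r_sqrt : r%:R <= 2%:R * Num.sqrt n%:R :> R.
  rewrite -ler_sqr ?nnegrE ?mulr_ge0 ?sqrtr_ge0 ?ler0n // exprMn sqr_sqrtr ?ler0n //.
  rewrite -!natrX -natrM ler_nat; lia.
have Hd := phi_approx_deg k_gt1 nE erefl varA varB (erefl : val t0 = 0%N) G slot_deg b hc.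
(* As [k >= 2], [5 * k * r * (20 * k + 20) <= 150 * r * k ^ 2]. *)
have {}Hd : (approx_deg R (joint (phi varA varB slot t0 G b)) <= 150 * r * k ^ 2)%N.
  by apply: leq_trans Hd _; rewrite /w; nia.
apply: (@le_trans _ _ (150 * r * k ^ 2)%:R); first by rewrite ler_nat.
rewrite (natrM _ (150 * r)) (natrM _ 150) natrX ler_wpM2r ?exprn_ge0 ?ler0n //.
have -> : 300%:R = 150%:R * 2%:R :> R by rewrite -natrM.
by rewrite -mulrA ler_wpM2l // ler0n.
Qed.
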